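(* Let $\mathcal H$ be any infinite dimensional Hilbert space. There exist orthogonal projections $Q_1,Q_2,Q_3$ in $\mathcal H$, a vector $x\in\mathcal H$, and integers $m_i\ge 1$, $p_i\ge 1$ ($i\ge 1$) such that the sequence of vectors $$\prod_{1\le i\le j}\bigl(Q_3\,(Q_2Q_1Q_2)^{p_i}\,Q_3\bigr)^{m_i}\,x,\qquad j=1,2,\dots,$$ diverges in norm as $j\to\infty$ (i.e. does not converge in the norm of $\mathcal H$).
   Context: For bounded operators $A_1,\dots,A_j$ on $\mathcal H$, the product notation means $\prod_{1\le i\le j}A_i = A_jA_{j-1}\cdots A_1$ (the factor with the smallest index acts first). *)

(* Defs.v *)
From mathcomp Require Import all_boot all_order all_algebra.
From mathcomp Require Import complex.
From mathcomp Require Import all_classical all_reals all_analysis.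

Set Implicit Arguments.
Unset Strict Implicit.
Unset Printing Implicit Defensive.

Import Order.TTheory GRing.Theory Num.Theory.
Import numFieldNormedType.Exports.

Local Open Scope classical_set_scope.
Local Open Scope ring_scope.

(* A Hilbert space may be real or complex. *)
Inductive scalar_kind := RealScalars | ComplexScalars.

Definition scalars (R : realType) (k : scalar_kind) : numFieldType :=
  match k with
  | RealScalars => R
  | ComplexScalars => R[i]
  end.

Definition scalar_conj (R : realType) (k : scalar_kind) :
    {rmorphism scalars R k -> scalars R k} :=
  match k with
  | RealScalars => idfun
  | ComplexScalars => Num.conj
  end.

Section Hilbert.
Variables (R : realType) (k : scalar_kind).
Variable H : completeNormedModType (scalars R k).

(* With H complete, this makes (H, ip) a Hilbert space; ip is linear in its
   first argument and conjugate-linear in the second, and norms take values in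
   the scalar field. *)
Definition norm_from_dot (ip : {dot H for scalar_conj R k}) : Prop :=
  forall x : H, `|x| ^+ 2 = ip x x.

Definition finite_dimensional : Prop :=
  exists (n : nat) (e : 'I_n -> H),
    forall x : H, exists c : 'I_n -> scalars R k, x = \sum_(i < n) c i *: e i.

Definition closed_subspace (M : set H) : Prop :=
  [/\ M 0, forall (a : scalars R k) (u v : H), M u -> M v -> M (a *: u + v)
    & closed M].

Definition orthogonal_projection_onto (ip : {dot H for scalar_conj R k})
    (M : set H) (Q : H -> H) : Prop :=
  forall x : H, M (Q x) /\ forall y : H, M y -> ip (x - Q x) y = 0.

Definition orthogonal_projection (ip : {dot H for scalar_conj R k})
    (Q : H -> H) : Prop :=
  exists M : set H, closed_subspace M /\ orthogonal_projection_onto ip M Q.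

End Hilbert.

(* A j \o ... \o A 2 \o A 1: the factor of smallest index acts first, and
   A 0 is not used. *)
Fixpoint ordered_prod (T : Type) (A : nat -> T -> T) (j : nat) : T -> T :=
  if j is j'.+1 then A j'.+1 \o ordered_prod A j' else id.

(* Main.v *)
Require Import Defs.
From mathcomp Require Import all_boot all_order all_algebra.
From mathcomp Require Import complex.
From mathcomp Require Import all_classical all_reals all_analysis.
From mathcomp Require Import ring lra zify.
Import Order.TTheory GRing.Theory Num.Theory.
Import numFieldNormedType.Exports.
Local Open Scope classical_set_scope.
Local Open Scope ring_scope.

(** The vector is moved along an orthonormal sequence f_0, f_1, f_2, ... of the
range of Q3: during stage [s] it is rotated inside the plane of f_s and
f_{s+1}, in [2 ^ s] equal steps, from f_s to f_{s+1}. A step projects onto a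
line at angle O(2^-s), which loses O(4^-s) in norm; these losses are summable,
so from a late stage on the vector stays close to the f_s and cannot converge.

The projection of step [n] is the approximate kernel of a rank-one form: with
w_n the unit vector of the plane orthogonal to the new line, the compression
B_p of (Q2 Q1 Q2)^p to the range of Q3 is
[1 - \sum_n (1 - (1 - x_n) ^ p) rho_n |w_n><w_n|].
If [p] is large for [x_n], and every other term meeting the plane of step [n]
either has [rho_j] much smaller than [rho_n] or [x_j] much smaller than
[1 / p], then B_p is close to [1 - rho_n |w_n><w_n|] on that plane, and a high
power of it kills [w_n]. Terms interact only within a stage or between adjacent
stages. Within a stage [rho] grows and [x] decreases in time; stages of odd
index have larger [rho] and smaller [x] than the two neighbouring even ones.
This makes infinitely many stages compatible with integer exponents [p], for
which a globally monotone choice is impossible.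

For the dilation, orthonormal vectors e_s, g_n, h_n, g'_n are chosen. Q2 and Q1
are the projections onto the complements of the g'_n and of the vectors
[sqrt x_n g_n - sqrt (1 - x_n) g'_n], so that Q2 Q1 Q2 multiplies g_n by
[1 - x_n] and fixes e_s and h_n; f_s combines e_s with the g_n and h_n so that
Q3 g_n = sqrt rho_n w_n, the h_n serving to make the f_s orthogonal. *)

Set Implicit Arguments.
Unset Strict Implicit.
Unset Printing Implicit Defensive.

(** * Real numbers inside the real or complex scalar field *)

Definition of_real (R : realType) (k : scalar_kind) :
    {rmorphism R -> scalars R k} :=
  match k return {rmorphism R -> scalars R k} with
  | RealScalars => idfun
  | ComplexScalars => real_complex R
  end.

Definition re_part (R : realType) (k : scalar_kind) : scalars R k -> R :=
  match k return scalars R k -> R with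
  | RealScalars => id
  | ComplexScalars => @complex.Re R
  end.

Section Scalars.
Variables (R : realType) (k : scalar_kind).
Local Notation K := (scalars R k).
Local Notation "r %:K" := (of_real R k r) (at level 2, format "r %:K").

Lemma ler_of_real (x y : R) : (x%:K <= y%:K) = (x <= y).
Proof. by case: k => //=; exact: lecR. Qed.

Lemma ltr_of_real (x y : R) : (x%:K < y%:K) = (x < y).
Proof. by rewrite !lt_def (inj_eq (fmorph_inj _)) ler_of_real. Qed.

Lemma re_part_ge0 (a : K) : 0 <= a -> (re_part a)%:K = a.
Proof.
case: k a => //= a a0.
by apply: RRe_real; exact: ger0_real.
Qed.

Lemma of_realK : cancel (of_real R k) (@re_part R k).
Proof. by case: k. Qed.

Lemma of_real_inj : injective (of_real R k).
Proof. exact: can_inj of_realK. Qed.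

Lemma conj_of_real (r : R) : scalar_conj R k r%:K = r%:K.
Proof.
case: k => //=; apply: CrealP; rewrite realE.
by case: (lerP 0 r) => h; rewrite ?lecR ?h ?(ltW h) ?orbT.
Qed.

Lemma mul_conj (a : K) : a * scalar_conj R k a = `|a| ^+ 2.
Proof.
case: k a => /= a; first by rewrite -expr2 real_normK ?num_real.
by rewrite normCK.
Qed.

Lemma norm_of_real (r : R) : `|r%:K| = `|r|%:K.
Proof.
have [r0|r0] := lerP 0 r; first by rewrite !ger0_norm // -(rmorph0 (of_real R k)) ler_of_real.
by rewrite !ltr0_norm ?rmorphN // -(rmorph0 (of_real R k)) ltr_of_real.
Qed.
End Scalars.

(** * Inner product geometry and orthogonal complements *)

Section InnerProduct.
Variables (R : realType) (k : scalar_kind).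
Local Notation K := (scalars R k).
Local Notation "r %:K" := (of_real R k r) (at level 2, format "r %:K").
Variables (H : completeNormedModType K) (ip : {dot H for scalar_conj R k}).
Hypothesis hip : norm_from_dot ip.

(** The norm of [H] takes values in the scalar field; this real version gives access to the total
    order of [R] for both kinds of scalars. *)
Definition rnorm (x : H) : R := re_part `|x|.

Lemma rnormE x : (rnorm x)%:K = `|x|.
Proof. by rewrite /rnorm re_part_ge0. Qed.

Lemma rnorm_ge0 x : 0 <= rnorm x.
Proof. by rewrite -(ler_of_real k) rnormE rmorph0. Qed.

Lemma rnorm0 : rnorm 0 = 0.
Proof. by apply: (@of_real_inj R k); rewrite rnormE normr0 rmorph0. Qed.

Lemma ler_rnormD x y : rnorm (x + y) <= rnorm x + rnorm y.
Proof. by rewrite -(ler_of_real k) rmorphD !rnormE ler_normD. Qed.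

Lemma rnormN x : rnorm (- x) = rnorm x.
Proof. by rewrite /rnorm normrN. Qed.

Lemma ler_rnormB x y : rnorm (x - y) <= rnorm x + rnorm y.
Proof. by rewrite -(rnormN y) ler_rnormD. Qed.

Lemma rnormZ (r : R) x : rnorm (r%:K *: x) = `|r| * rnorm x.
Proof.
apply: (@of_real_inj R k).
by rewrite rmorphM !rnormE normrZ norm_of_real.
Qed.

Lemma rnorm_sqr x : (rnorm x ^+ 2)%:K = ip x x.
Proof. by rewrite rmorphXn /= rnormE hip. Qed.

Lemma ler_rnorm_sum I (r : seq I) (P : pred I) (F : I -> H) :
  rnorm (\sum_(i <- r | P i) F i) <= \sum_(i <- r | P i) rnorm (F i).
Proof.
elim/big_ind2: _ => // [|x a y b xa yb]; first by rewrite rnorm0.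
by rewrite (le_trans (ler_rnormD _ _)) ?lerD.
Qed.

Lemma ipC x y : ip y x = scalar_conj R k (ip x y).
Proof. by rewrite (hermC ip) expr0 mul1r. Qed.

Lemma ip_eq0C x y : ip x y = 0 -> ip y x = 0.
Proof. by move=> h; rewrite ipC h rmorph0. Qed.

Lemma ipZl a x y : ip (a *: x) y = a * ip x y.
Proof. exact: linearZl_LR. Qed.

Lemma ipZr (r : R) x y : ip x (r%:K *: y) = r%:K * ip x y.
Proof. by rewrite linearZr_LR /= conj_of_real. Qed.

Lemma ipDl x y z : ip (x + y) z = ip x z + ip y z.
Proof. exact: linearDl. Qed.

Lemma ipBl x y z : ip (x - y) z = ip x z - ip y z.
Proof. exact: linearBl. Qed.

Lemma ipBr x y z : ip z (x - y) = ip z x - ip z y.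
Proof. exact: linearBr. Qed.

Lemma pythagoras x y : ip x y = 0 ->
  rnorm (x + y) ^+ 2 = rnorm x ^+ 2 + rnorm y ^+ 2.
Proof.
move=> xy0; apply: (@of_real_inj R k).
by rewrite rmorphD !rnorm_sqr hnormDd.
Qed.

Lemma parallelogram x y :
  rnorm (x + y) ^+ 2 + rnorm (x - y) ^+ 2 =
  rnorm x ^+ 2 *+ 2 + rnorm y ^+ 2 *+ 2.
Proof.
apply: (@of_real_inj R k).
rewrite !mulr2n !rmorphD !rnorm_sqr.
rewrite (hnormD ip) (hnormB ip) addrACA subrr addr0.
by rewrite addrACA.
Qed.

(* The witness [a] makes [a *: y] the projection of [x] onto the line of [y]. *)
Lemma distance_to_line x y : y != 0 ->
  exists a : K, (rnorm (x - a *: y) ^+ 2)%:K = ip x x - `|ip x y| ^+ 2 / ip y y.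
Proof.
move=> y0; have nz : ip y y != 0 by rewrite -hip expf_neq0 // normr_eq0.
exists (ip x y / ip y y).
rewrite rnorm_sqr !(linearDl, linearDr, linearNl, linearNr) /=.
rewrite !ipZl !linearZr_LR /= (ipC x y) rmorphM fmorphV.
rewrite -(ipC y y) -mul_conj.
rewrite divfK // opprK -[_ *: _]/(_ * _) [X in _ + X]addrC addrA subrK.
by rewrite mulrAC.
Qed.

(** The squared distance from [x] to the line of [y] is nonnegative. *)
Lemma cauchy_schwarz x y : `|ip x y| <= `|x| * `|y|.
Proof.
have [->|y0] := eqVneq y 0; first by rewrite linear0r !normr0 mulr0.
have y2 : 0 < ip y y by rewrite -hip exprn_gt0 // normr_gt0.
have [a ha] := distance_to_line x y0.
rewrite -(ler_pXn2r (n := 2)) ?nnegrE ?mulr_ge0 // exprMn !hip.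
rewrite -ler_pdivrMr // -subr_ge0 -ha.
by rewrite -(rmorph0 (of_real R k)) ler_of_real sqr_ge0.
Qed.

Lemma closed_orthogonal (S : set H) :
  closed [set x | forall y, S y -> ip x y = 0].
Proof.
move=> x clx y Sy /=.
apply/eqP; rewrite -normr_le0; apply/ler_addgt0Pr => e e0; rewrite add0r.
(* The [+ 1] keeps the radius positive when [y] is zero. *)
have d0 : 0 < e / (`|y| + 1) by rewrite divr_gt0 // ltr_wpDl.
have [z [/= zS]] := clx _ (nbhsx_ballx x _ d0).
rewrite -ball_normE /= => xz.
have -> : ip x y = ip (x - z) y by rewrite ipBl (zS _ Sy) subr0.
apply: (le_trans (cauchy_schwarz _ _)).
apply: (le_trans (ler_wpM2r _ (ltW xz))) => //.
by rewrite mulrAC ler_pdivrMr ?ltr_wpDl // ler_wpM2l ?(ltW e0) // lerDl.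
Qed.

Lemma closed_subspace_orthogonal (S : set H) :
  closed_subspace [set x | forall y, S y -> ip x y = 0].
Proof.
split; last exact: closed_orthogonal.
  by move=> y _; rewrite linear0l.
by move=> a u v hu hv y Sy; rewrite ipDl ipZl hu // hv // mulr0 addr0.
Qed.

End InnerProduct.

(** * Existence of the orthogonal projection onto a closed subspace *)

Section Projections.
Variables (R : realType) (k : scalar_kind).
Local Notation K := (scalars R k).
Local Notation "r %:K" := (of_real R k r) (at level 2, format "r %:K").
Variables (H : completeNormedModType K) (ip : {dot H for scalar_conj R k}).
Hypothesis hip : norm_from_dot ip.

Lemma ltr_rnorm (x : H) (e : K) : 0 < e -> rnorm x < re_part e -> `|x| < e.
Proof.
by move=> /ltW e0; rewrite -(ltr_of_real k) rnormE re_part_ge0.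
Qed.

Lemma re_part_gt0 (e : K) : 0 < e -> 0 < re_part e.
Proof.
by move=> e0; rewrite -(ltr_of_real k) re_part_ge0 ?(ltW e0) // rmorph0.
Qed.

Lemma subspace_half (M : set H) (u v : H) : closed_subspace M ->
  M u -> M v -> M ((2^-1)%:K *: (u + v)).
Proof.
case=> M0 ML _ Mu Mv; rewrite scalerDr; apply: (ML) => //.
by rewrite -[X in M X]addr0; apply: ML.
Qed.

Section Minimizer.
Variables (M : set H) (x : H) (d : R).
Hypothesis hM : closed_subspace M.
Hypothesis hd : forall m, M m -> d <= rnorm (x - m).
Hypothesis d0 : 0 <= d.

(** Parallelogram law: the midpoint of [u] and [v] lies in [M], hence at distance at least [d] from
    [x], which leaves at most [4 (d + e)^2 - 4 d^2] for the squared distance of [u] and [v]. *)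
Lemma minimizing_close (u v : H) (e : R) : 0 <= e -> e <= 1 -> M u -> M v ->
  rnorm (x - u) <= d + e -> rnorm (x - v) <= d + e ->
  rnorm (u - v) ^+ 2 <= (8 * d + 4) * e.
Proof.
move=> e0 e1 Mu Mv hu hv.
have := parallelogram hip (x - v) (x - u).
rewrite -[x - v - (x - u)]/(x - v + - (x - u)).
have -> : x - v + - (x - u) = u - v by rewrite opprB addrC addrA subrK.
have -> : x - v + (x - u) = 2%:K *: (x - (2^-1)%:K *: (u + v)).
  rewrite scalerBr scalerA -rmorphM /= divff // rmorph1 scale1r rmorph_nat.
  by rewrite scaler_nat mulr2n opprD addrACA [- u - v]addrC.
rewrite rnormZ ger0_norm //.
have := hd (subspace_half hM Mu Mv).
move: (_ *: _) => w hw E.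
have : d ^+ 2 <= rnorm (x - w) ^+ 2 by rewrite ler_pXn2r ?nnegrE ?rnorm_ge0.
have : rnorm (x - u) ^+ 2 <= (d + e) ^+ 2.
  by rewrite ler_pXn2r ?nnegrE ?rnorm_ge0 ?addr_ge0.
have : rnorm (x - v) ^+ 2 <= (d + e) ^+ 2.
  by rewrite ler_pXn2r ?nnegrE ?rnorm_ge0 ?addr_ge0.
have : e ^+ 2 <= e by rewrite expr2 ler_piMr.
move: E; nra.
Qed.

Hypothesis hdI : forall e : R, 0 < e -> exists2 m, M m & rnorm (x - m) < d + e.

(** A minimizing sequence with errors [1 / (n + 1)] is Cauchy by [minimizing_close], and its limit
    stays in the closed set [M]. *)
Lemma minimizer_exists : exists2 q, M q & rnorm (x - q) <= d.
Proof.
have /choice[u hu] : forall n : nat, exists m, M m /\ rnorm (x - m) <= d + n.+1%:R^-1.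
  move=> n; have n0 : 0 < n.+1%:R^-1 :> R by rewrite invr_gt0.
  by have [m Mm /ltW ?] := hdI n0; exists m.
have small (e : R) : 0 < e -> exists n0 : nat, forall n, (n0 <= n)%N -> n.+1%:R^-1 < e.
  move=> e0; exists (Num.truncn e^-1) => n hn.
  rewrite invf_plt ?posrE //; apply: (lt_le_trans (truncnS_gt _)).
  by rewrite ler_nat ltnS.
have cu : cvg (u @ \oo).
  apply/cauchy_cvgP/cauchy_exP => e e0.
  have e'0 := re_part_gt0 e0.
  have c0 : 0 < 8 * d + 4 by rewrite ltr_wpDl // mulr_ge0.
  have [n0 hn0] := small (re_part e ^+ 2 / (8 * d + 4)) (divr_gt0 (exprn_gt0 2 e'0) c0).
  exists (u n0); exists n0 => // n /= hn.
  rewrite -ball_normE /=; apply: ltr_rnorm => //.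
  rewrite -(ltr_pXn2r (n := 2)) ?nnegrE ?rnorm_ge0 ?(ltW e'0) //.
  apply: (@le_lt_trans _ _ ((8 * d + 4) * n0.+1%:R^-1)); last first.
    by rewrite mulrC -ltr_pdivlMr // hn0.
  apply: minimizing_close; rewrite ?invr_ge0 ?invf_le1 ?ler1n //; try by case: (hu n0); case: (hu n).
  case: (hu n) => _ h; apply: (le_trans h); rewrite lerD2l lef_pV2 ?posrE //.
  by rewrite ler_nat ltnS.
exists (lim (u @ \oo)).
  case: hM => _ _ cM; apply: (@closed_cvg _ _ _ _ u M cM _ _ cu).
  by near=> n; case: (hu n).
apply/ler_addgt0Pr => e e0.
have e20 : 0 < e / 2 by rewrite divr_gt0.
have [n0 hn0] := small _ e20.
have eK : 0 < (e / 2)%:K by rewrite -(rmorph0 (of_real R k)) ltr_of_real.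
have /cvgrPdist_lt/(_ _ eK) := cu.
move=> [n1 _ /(_ (maxn n0 n1)) /=]; rewrite leq_maxr => /(_ isT).
rewrite -rnormE ltr_of_real => h1.
have [_ h2] := hu (maxn n0 n1).
have h3 := hn0 _ (leq_maxl n0 n1).
have := ler_rnormB (x - u (maxn n0 n1)) (lim (u @ \oo) - u (maxn n0 n1)).
rewrite opprB addrA subrK => /le_trans; apply.
rewrite [e]splitr addrA lerD ?(ltW h1) // (le_trans h2) // lerD2l.
by rewrite ltW.
Unshelve. all: by end_near.
Qed.

End Minimizer.

Lemma projection_exists (M : set H) : closed_subspace M ->
  exists Q : H -> H, orthogonal_projection_onto ip M Q.
Proof.
move=> hM.
suff /choice[Q hQ] : forall x, exists q, M q /\ forall y, M y -> ip (x - q) y = 0 by exists Q.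
move=> x.
have [M0 ML cM] := hM.
pose D := [set rnorm (x - m) | m in M].
have lbD : lbound D 0 by move=> _ [m _ <-]; exact: rnorm_ge0.
have infD : has_inf D by split; [exists (rnorm (x - 0)); exists 0|exists 0].
have hd m : M m -> inf D <= rnorm (x - m).
  by move=> Mm; apply: ge_inf; [case: infD|exists m].
have d0 : 0 <= inf D by apply: lb_le_inf => //; case: infD.
have hdI e : 0 < e -> exists2 m, M m & rnorm (x - m) < inf D + e.
  by move=> e0; have [_ [m Mm <-] ?] := inf_adherent e0 infD; exists m.
have [q Mq hq] := minimizer_exists hM hd d0 hdI.
exists q; split => // y My.
have [->|y0] := eqVneq y 0; first exact: linear0r.
have y2 : 0 < ip y y by rewrite -hip exprn_gt0 // normr_gt0.
have [a ha] := distance_to_line hip (x - q) y0.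
(* Replacing [q] by [q + a *: y], still in [M], cannot beat the infimum, so the gain given by
   [distance_to_line] must vanish. *)
have : ip (x - q) (x - q) <= ip (x - q) (x - q) - `|ip (x - q) y| ^+ 2 / ip y y.
  rewrite -ha -rnorm_sqr // ler_of_real.
  rewrite ler_pXn2r ?nnegrE ?rnorm_ge0 //.
  rewrite -addrA -opprD (le_trans hq) // hd // addrC.
  exact: ML.
rewrite lerBrDl -lerBrDr subrr pmulr_lle0 ?invr_gt0 //.
move=> le0; apply/eqP; rewrite -normr_eq0 -sqrf_eq0.
by rewrite eq_le le0 exprn_ge0.
Qed.
End Projections.

(** * Linear contractions, properties of projections, orthonormal sequences *)

Section ProjectionProperties.
Variables (R : realType) (k : scalar_kind).
Local Notation K := (scalars R k).
Local Notation "r %:K" := (of_real R k r) (at level 2, format "r %:K").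
Variables (H : completeNormedModType K) (ip : {dot H for scalar_conj R k}).
Hypothesis hip : norm_from_dot ip.

(** Unlike being a projection, this is stable under composition and iteration. *)
Definition linear_contraction (A : H -> H) : Prop :=
  (forall (a : K) u v, A (a *: u + v) = a *: A u + A v) /\
  (forall u, rnorm (A u) <= rnorm u).

Lemma linear_contraction_comp A B :
  linear_contraction A -> linear_contraction B -> linear_contraction (A \o B).
Proof.
move=> [LA CA] [LB CB]; split=> [a u v|u] /=; first by rewrite LB LA.
exact: le_trans (CA _) (CB _).
Qed.

Lemma linear_contraction_iter n A :
  linear_contraction A -> linear_contraction (iter n A).
Proof.
move=> hA; elim: n => [|n IH]; first by split.
exact: linear_contraction_comp.
Qed.

Section LinearContraction.
Variable A : H -> H.
Hypothesis hA : linear_contraction A.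

Lemma linear_contraction0 : A 0 = 0.
Proof.
by have [LA _] := hA; have := LA (-1) 0 0; rewrite scaleN1r oppr0 addr0 scaleN1r addNr.
Qed.

Lemma linear_contractionD u v : A (u + v) = A u + A v.
Proof. by have [LA _] := hA; have := LA 1 u v; rewrite !scale1r. Qed.

Lemma linear_contractionZ a u : A (a *: u) = a *: A u.
Proof.
have [LA _] := hA; have := LA a u 0.
by rewrite linear_contraction0 !addr0.
Qed.

Lemma linear_contractionB u v : A (u - v) = A u - A v.
Proof. by rewrite linear_contractionD -scaleN1r linear_contractionZ scaleN1r. Qed.

Lemma linear_contraction_sum I (r : seq I) (P : pred I) (F : I -> H) :
  A (\sum_(i <- r | P i) F i) = \sum_(i <- r | P i) A (F i).
Proof.
exact: (big_morph A linear_contractionD linear_contraction0).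
Qed.

Lemma linear_contraction_dist u v : rnorm (A u - A v) <= rnorm (u - v).
Proof. by rewrite -linear_contractionB; case: hA. Qed.

End LinearContraction.

Section Onto.
Variables (M : set H) (Q : H -> H).
Hypothesis hM : closed_subspace M.
Hypothesis hQ : orthogonal_projection_onto ip M Q.

(** [Q x - q] lies in [M] and is a difference of two vectors orthogonal to [M], hence is orthogonal
    to itself. *)
Lemma projection_unique x q :
  M q -> (forall y, M y -> ip (x - q) y = 0) -> Q x = q.
Proof.
move=> Mq hq; have [MQ hx] := hQ x; have [M0 ML _] := hM.
have Md : M (Q x - q) by rewrite addrC -scaleN1r; exact: ML.
apply/eqP; rewrite -subr_eq0 -normr_eq0 -sqrf_eq0 hip.
have {1}-> : Q x - q = (x - q) - (x - Q x) by rewrite opprB [RHS]addrC addrA subrK.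
by rewrite ipBl hq // hx // subrr.
Qed.

Lemma projection_id x : M x -> Q x = x.
Proof. by move=> Mx; apply: projection_unique => // y _; rewrite subrr linear0l. Qed.

Lemma projection_eq0 x : (forall y, M y -> ip x y = 0) -> Q x = 0.
Proof.
by move=> h; apply: projection_unique => [|y /h]; [case: hM|rewrite subr0].
Qed.

Lemma projection_contraction : linear_contraction Q.
Proof.
have [M0 ML _] := hM.
split=> [a u v|u].
  have [Mu hu] := hQ u; have [Mv hv] := hQ v.
  apply: projection_unique => [|y My]; first exact: ML.
  rewrite opprD addrACA -scalerBr ipDl ipZl hu // hv //.
  by rewrite mulr0 addr0.
have [Mu hu] := hQ u.
have /(pythagoras hip) := hu _ Mu.
rewrite subrK => h.
rewrite -(ler_pXn2r (n := 2)) ?nnegrE ?rnorm_ge0 // h lerDr.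
exact: sqr_ge0.
Qed.
End Onto.

Definition orthonormal_family (I : eqType) (u : I -> H) : Prop :=
  forall i j, ip (u i) (u j) = (i == j)%:R.

(** Gram-Schmidt: if every residual [r x] vanished, the first [n] vectors would span [H]. *)
Lemma orthonormal_extend (n : nat) (s : nat -> H) : ~ finite_dimensional H ->
  (forall i j, (i < n)%N -> (j < n)%N -> ip (s i) (s j) = (i == j)%:R) ->
  exists v, ip v v = 1 /\ forall i, (i < n)%N -> ip v (s i) = 0.
Proof.
move=> hdim hs.
pose r x := x - \sum_(i < n) ip x (s i) *: s i.
have rs x j : (j < n)%N -> ip (r x) (s j) = 0.
  move=> jn; rewrite ipBl linear_sumlz (bigD1 (Ordinal jn)) //= big1.
    by rewrite addr0 ipZl hs // eqxx mulr1 subrr.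
  move=> i ij; rewrite ipZl hs // -[j]/(nat_of_ord (Ordinal jn)) (inj_eq val_inj).
  by rewrite (negPf ij) mulr0.
have [x rx] : exists x, r x != 0.
  apply: contrapT => /forallNP h; apply: hdim; exists n, (fun i => s i) => x.
  exists (fun i => ip x (s i)); apply/eqP; rewrite -subr_eq0.
  by apply/negPn/negP => /h.
exists ((rnorm (r x))^-1%:K *: r x).
have n0 : (rnorm (r x))%:K != 0 by rewrite rnormE normr_eq0.
split=> [|i hi]; last by rewrite ipZl rs // mulr0.
rewrite ipZl ipZr -rnorm_sqr // -!rmorphM /= expr2 mulKf.
  by rewrite mulVf ?rmorph1 // -(fmorph_eq0 (of_real R k)).
by rewrite -(fmorph_eq0 (of_real R k)).
Qed.

Lemma orthonormal_sequence_exists : ~ finite_dimensional H ->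
  exists u : nat -> H, orthonormal_family u.
Proof.
move=> hdim.
pose good (s : seq H) := forall i j, (i < size s)%N -> (j < size s)%N ->
  ip s`_i s`_j = (i == j)%:R.
(* [choice] yields a total function on lists, so lists that are not orthonormal get the default
   0. *)
have /choice[next hnext] : forall s, exists v, good s -> good (rcons s v).
  move=> s; have [gs|ngs] := pselect (good s); last by exists 0.
  have [v [v1 vs]] := orthonormal_extend hdim gs.
  exists v => _ i j; rewrite size_rcons !nth_rcons !ltnS.
  rewrite [(i <= _)%N]leq_eqVlt [(j <= _)%N]leq_eqVlt.
  have svi l : (l < size s)%N -> ip s`_l v = 0 by move=> ?; apply: ip_eq0C; exact: vs.
  move=> /orP[/eqP->|hi] /orP[/eqP->|hj]; rewrite ?ltnn ?eqxx ?hi ?hj //.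
  - by rewrite vs // gtn_eqF.
  - by rewrite svi // ltn_eqF.
  - exact: gs.
pose L n := iter n (fun s => rcons s (next s)) [::].
have sL n : size (L n) = n by elim: n => //= n IH; rewrite size_rcons IH.
have gL n : good (L n) by elim: n => [|n IH] //=; exact: hnext.
have nL n m : (n < m)%N -> (L m)`_n = (L n.+1)`_n.
  elim: m => // m IH; rewrite ltnS leq_eqVlt => /orP[/eqP->//|nm].
  by rewrite /= nth_rcons sL nm IH.
exists (fun n => (L n.+1)`_n) => i j.
rewrite -(nL i (maxn i j).+1) ?ltnS ?leq_maxl //.
rewrite -(nL j (maxn i j).+1) ?ltnS ?leq_maxr //.
by apply: gL; rewrite sL ltnS ?leq_maxl ?leq_maxr.
Qed.

Lemma orthonormal_family_exists (I : countType) : ~ finite_dimensional H ->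
  exists u : I -> H, orthonormal_family u.
Proof.
move=> /orthonormal_sequence_exists[u hu]; exists (u \o pickle) => i j /=.
by rewrite hu (inj_eq (pcan_inj pickleK)).
Qed.
End ProjectionProperties.

(** * Three projections whose products compress to prescribed rank-one perturbations *)

Section Dilation.
Variables (R : realType) (k : scalar_kind).
Local Notation K := (scalars R k).
Local Notation "r %:K" := (of_real R k r) (at level 2, format "r %:K").
Variables (H : completeNormedModType K) (ip : {dot H for scalar_conj R k}).
Hypothesis hip : norm_from_dot ip.
Hypothesis hdim : ~ finite_dimensional H.

Variables (t N : nat -> nat) (b c x : nat -> R).

(** Coefficient on [f s] of the vector with coordinates [b n], [c n] in the plane of step [n],
    spanned by [f (t n)] and [f (t n).+1]. *)
Definition incidence (n s : nat) : R :=
  (t n == s)%:R * b n + ((t n).+1 == s)%:R * c n.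

(** The first sign is flipped so that, for two distinct stages, the products of [skew] cancel those
    of [incidence]; this makes the [f s] orthogonal. *)
Let skew (n s : nat) : R :=
  - ((t n == s)%:R * b n) + ((t n).+1 == s)%:R * c n.

(** From [N s] on no step meets [f s], so every sum over steps is finite. *)
Hypothesis hN : forall n s, (N s <= n)%N -> (s < t n)%N.
Hypothesis hx : forall n, 0 <= x n <= 1.
Hypothesis hbc : forall s, 2 * \sum_(n < N s) incidence n s ^+ 2 <= 1.

Let incidence_out n s : (N s <= n)%N -> incidence n s = 0.
Proof.
move=> /hN h; rewrite /incidence !gtn_eqF ?mul0r ?addr0 //.
exact: leqW.
Qed.

Let skew_out n s : (N s <= n)%N -> skew n s = 0.
Proof.
move=> /hN h; rewrite /skew !gtn_eqF ?mul0r ?oppr0 ?addr0 //.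
exact: leqW.
Qed.

Let incidence_skew n s s' :
  incidence n s * incidence n s' + skew n s * skew n s' =
  (s == s')%:R * (2 * incidence n s ^+ 2).
Proof.
rewrite /incidence /skew; have Sn m : (m.+1 == m) = false by rewrite gtn_eqF.
have [->|ss'] := eqVneq s s'.
  have [->|h1] := eqVneq (t n) s'; last by rewrite /=; ring.
  by rewrite Sn /=; ring.
have [e1|h1] := eqVneq (t n) s; have [e2|h2] := eqVneq (t n) s'.
- by rewrite -e1 -e2 eqxx in ss'.
- by rewrite -e1 Sn /=; ring.
- by rewrite -e2 Sn /=; ring.
have [e3|h3] := eqVneq (t n).+1 s; have [e4|h4] := eqVneq (t n).+1 s'; try by rewrite /=; ring.
by rewrite -e3 -e4 eqxx in ss'.
Qed.

Section Vectors.
Variable u : nat * nat -> H.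
Hypothesis hu : orthonormal_family ip u.
Let e n := u (0%N, n).
Let g n := u (1%N, n).
Let h n := u (2%N, n).
Let g' n := u (3%N, n).

(** The mass left for [e s] in the unit vector [f s]; the factor 2 accounts for the equal
    contributions of the [g n] and the [h n]. *)
Let alpha s := Num.sqrt (1 - 2 * \sum_(n < N s) incidence n s ^+ 2).

Let f s : H := (alpha s)%:K *: e s +
  \sum_(n < N s) ((incidence n s)%:K *: g n + (skew n s)%:K *: h n).

Let ip_basis i j m n : i != j -> ip (u (i, m)) (u (j, n)) = 0.
Proof. by move=> ij; rewrite hu xpair_eqE (negPf ij). Qed.

Let ip_basis_eq i m n : ip (u (i, m)) (u (i, n)) = (m == n)%:R.
Proof. by rewrite hu xpair_eqE eqxx. Qed.

Let sum_delta (F : nat -> K) M n : ((M <= n)%N -> F n = 0) ->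
  \sum_(i < M) F i * (nat_of_ord i == n)%:R = F n.
Proof.
move=> F0; have [nM|Mn] := ltnP n M.
  rewrite (bigD1 (Ordinal nM)) //= eqxx mulr1 big1 ?addr0 // => i iM.
  by rewrite -[n]/(nat_of_ord (Ordinal nM)) (inj_eq val_inj) (negPf iM) mulr0.
rewrite F0 // big1 // => i _.
by rewrite ltn_eqF ?mulr0 // (leq_trans (ltn_ord i)).
Qed.

Let ip_f s v : ip (f s) v = (alpha s)%:K * ip (e s) v +
  \sum_(n < N s) ((incidence n s)%:K * ip (g n) v + (skew n s)%:K * ip (h n) v).
Proof.
rewrite ipDl ipZl linear_sumlz; congr (_ + _).
by apply: eq_bigr => n _; rewrite /= ipDl !ipZl.
Qed.

Let ip_f_e s m : ip (f s) (e m) = (alpha s)%:K * (s == m)%:R.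
Proof.
rewrite ip_f ip_basis_eq big1 ?addr0 // => n _.
by rewrite !ip_basis // !mulr0 addr0.
Qed.

Let ip_f_g s m : ip (f s) (g m) = (incidence m s)%:K.
Proof.
rewrite ip_f ip_basis // mulr0 add0r.
under eq_bigr do rewrite ip_basis_eq ip_basis // mulr0 addr0.
by rewrite (sum_delta (F := fun n => (incidence n s)%:K)) // => /incidence_out ->; rewrite rmorph0.
Qed.

Let ip_f_h s m : ip (f s) (h m) = (skew m s)%:K.
Proof.
rewrite ip_f ip_basis // mulr0 add0r.
under eq_bigr do rewrite ip_basis_eq ip_basis // mulr0 add0r.
by rewrite (sum_delta (F := fun n => (skew n s)%:K)) // => /skew_out ->; rewrite rmorph0.
Qed.

Let ip_g_f s m : ip (g m) (f s) = (incidence m s)%:K.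
Proof. by rewrite ipC ip_f_g conj_of_real. Qed.

Let orthonormal_f : orthonormal_family ip f.
Proof.
move=> s s'; rewrite {1}ip_f (ipC ip (f s')) ip_f_e rmorphM conj_of_real rmorph_nat.
under eq_bigr => n _.
  rewrite (ipC ip (f s') (g n)) (ipC ip (f s') (h n)) ip_f_g ip_f_h !conj_of_real.
  rewrite -!rmorphM -rmorphD incidence_skew.
  over.
rewrite -rmorph_sum -mulr_sumr -mulr_sumr.
have [<-|_] := eqVneq s s'; last by rewrite /= mul0r mulr0 !rmorph0 mulr0 addr0.
rewrite mul1r mulr1 -rmorphM -rmorphD -expr2 sqr_sqrtr ?subr_ge0 ?hbc //.
by rewrite subrK rmorph1.
Qed.

Let S1 := [set v | exists n, v = (Num.sqrt (x n))%:K *: g n - (Num.sqrt (1 - x n))%:K *: g' n].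
Let S2 := range g'.
(** The range of [Q3] is the orthogonal complement of this set, that is, the double complement of
    the [f s]. *)
Let S3 := [set v | forall s, ip v (f s) = 0].

Variables Q1 Q2 Q3 : H -> H.
Let orth (S : set H) := [set v | forall y, S y -> ip v y = 0].
Hypothesis hQ1 : orthogonal_projection_onto ip (orth S1) Q1.
Hypothesis hQ2 : orthogonal_projection_onto ip (orth S2) Q2.
Hypothesis hQ3 : orthogonal_projection_onto ip (orth S3) Q3.

Let cs S : closed_subspace (orth S). Proof. exact: closed_subspace_orthogonal. Qed.
Let L1 := projection_contraction hip (cs S1) hQ1.
Let L2 := projection_contraction hip (cs S2) hQ2.
Let L3 := projection_contraction hip (cs S3) hQ3.

Let Q3f s : Q3 (f s) = f s.
Proof.
by apply: (projection_id hip (cs S3) hQ3) => y /(_ s) /ip_eq0C.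
Qed.

(** Both sides have inner product [incidence n s] with every [f s], so [g n] minus the right side
    lies in [S3]. *)
Let Q3g n : Q3 (g n) = (b n)%:K *: f (t n) + (c n)%:K *: f (t n).+1.
Proof.
apply: (projection_unique hip (cs S3) hQ3) => [y Sy|y].
  by rewrite ipDl !ipZl !(ip_eq0C (Sy _)) !mulr0 addr0.
move=> hy; apply: ip_eq0C; apply: hy => s.
rewrite ipBl ip_g_f ipDl !ipZl !orthonormal_f.
rewrite /incidence rmorphD !rmorphM !rmorph_nat.
by rewrite ![_ * (_ == _)%:R]mulrC subrr.
Qed.

Let T := Q2 \o Q1 \o Q2.

Let LT : linear_contraction T.
Proof. by do 2![apply: linear_contraction_comp => //]. Qed.

Let T_fix v : (forall n, ip v (g n) = 0) -> (forall n, ip v (g' n) = 0) -> T v = v.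
Proof.
move=> vg vg'; rewrite /T /=.
have v2 : Q2 v = v by apply: (projection_id hip (cs S2) hQ2) => _ [n _ <-].
rewrite v2 (projection_id hip (cs S1) hQ1) // => _ [n ->].
by rewrite ipBr !ipZr vg vg' !mulr0 subrr.
Qed.

(** [Q1] subtracts [sqrt x] times the unit vector [q n], and [Q2] then erases the [g' n] part,
    leaving [g n] minus [x n] times itself. *)
Let T_g n : T (g n) = (1 - x n)%:K *: g n.
Proof.
have Q2g : Q2 (g n) = g n.
  by apply: (projection_id hip (cs S2) hQ2) => _ [m _ <-]; rewrite ip_basis.
have Q2g' : Q2 (g' n) = 0.
  by apply: (projection_eq0 hip (cs S2) hQ2) => y hy; apply/ip_eq0C/hy; exists n.
pose q n := (Num.sqrt (x n))%:K *: g n - (Num.sqrt (1 - x n))%:K *: g' n.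
have [x0 x1] := andP (hx n).
have Q1g : Q1 (g n) = g n - (Num.sqrt (x n))%:K *: q n.
  apply: (projection_unique hip (cs S1) hQ1) => [_ [m ->]|y hy].
    rewrite !(ipBl, ipZl, ipBr, ipZr) !ip_basis_eq !(ip_basis, mulr0, sub0r, subr0) //.
    have [<-|_] := eqVneq n m; last by rewrite !(mulr0, oppr0, subr0).
    rewrite /= !mulr1 mulrN opprK -!rmorphM -rmorphD -!expr2.
    by rewrite !sqr_sqrtr ?subr_ge0 // [x n + _]addrC subrK rmorph1 mulr1 subrr.
  rewrite opprB addrC subrK ipZl (ip_eq0C (hy _ _)) ?mulr0 //; by exists n.
rewrite /T /= Q2g Q1g (linear_contractionB L2) (linear_contractionZ L2) /q.
rewrite (linear_contractionB L2) !(linear_contractionZ L2) Q2g Q2g' scaler0 subr0.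
rewrite scalerA -rmorphM -expr2 sqr_sqrtr // rmorphB scalerBl.
by rewrite rmorph1 scale1r.
Qed.

Let Tp_fix p v : T v = v -> iter p T v = v.
Proof. by move=> Tv; elim: p => //= p ->. Qed.

Let Tp_g p n : iter p T (g n) = ((1 - x n) ^+ p)%:K *: g n.
Proof.
elim: p => [|p IH]; first by rewrite expr0 rmorph1 scale1r.
by rewrite iterS IH (linear_contractionZ LT) T_g scalerA -rmorphM -exprSr.
Qed.

(** In [f s] only the components on the [g n] are changed by [T]; [Q3] sends what they lose back to
    the planes of the steps. *)
Let compression p s : (Q3 \o iter p T \o Q3) (f s) = f s -
  \sum_(n < N s) (incidence n s * (1 - (1 - x n) ^+ p))%:K *:
    ((b n)%:K *: f (t n) + (c n)%:K *: f (t n).+1).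
Proof.
have Lp := linear_contraction_iter p LT.
have -> : (Q3 \o iter p T \o Q3) (f s) = Q3 (iter p T (f s)) by rewrite /= Q3f.
have -> : iter p T (f s) = f s -
    \sum_(n < N s) (incidence n s * (1 - (1 - x n) ^+ p))%:K *: g n.
  rewrite {1}/f (linear_contractionD Lp) (linear_contraction_sum Lp).
  rewrite (linear_contractionZ Lp) Tp_fix; last by apply: T_fix => n; rewrite ip_basis.
  rewrite /f -addrA -sumrB; congr (_ + _); apply: eq_bigr => n _.
  rewrite (linear_contractionD Lp) !(linear_contractionZ Lp) Tp_g Tp_fix; last first.
    by apply: T_fix => m; rewrite ip_basis.
  rewrite addrAC; congr (_ + _).
  by rewrite mulrBr mulr1 rmorphB scalerBl subKr rmorphM scalerA.
rewrite (linear_contractionB L3) Q3f (linear_contraction_sum L3).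
by congr (_ - _); apply: eq_bigr => n _; rewrite (linear_contractionZ L3) Q3g.
Qed.

Lemma dilation_family : orthonormal_family ip f /\ forall p s,
  (Q3 \o iter p (Q2 \o Q1 \o Q2) \o Q3) (f s) = f s -
  \sum_(n < N s) (incidence n s * (1 - (1 - x n) ^+ p))%:K *:
    ((b n)%:K *: f (t n) + (c n)%:K *: f (t n).+1).
Proof. by split. Qed.
End Vectors.

Theorem dilation : exists (Q1 Q2 Q3 : H -> H) (f : nat -> H),
  [/\ orthogonal_projection ip Q1, orthogonal_projection ip Q2,
      orthogonal_projection ip Q3, orthonormal_family ip f &
      forall p, linear_contraction (Q3 \o iter p (Q2 \o Q1 \o Q2) \o Q3) /\
      forall s, (Q3 \o iter p (Q2 \o Q1 \o Q2) \o Q3) (f s) = f s -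
        \sum_(n < N s) (incidence n s * (1 - (1 - x n) ^+ p))%:K *:
          ((b n)%:K *: f (t n) + (c n)%:K *: f (t n).+1)].
Proof.
have [u hu] := @orthonormal_family_exists R k H ip hip (nat * nat)%type hdim.
have cs S := @closed_subspace_orthogonal R k H ip hip S.
(* The three sets are [S3], [S2] and [S1] written out for the family [u]. *)
have [Q3 hQ3] := projection_exists hip (cs [set v | forall s, ip v ((Num.sqrt (1 - 2 * \sum_(n < N s) incidence n s ^+ 2))%:K *: u (0%N, s) +
  \sum_(n < N s) ((incidence n s)%:K *: u (1%N, nat_of_ord n) + (skew n s)%:K *: u (2%N, nat_of_ord n))) = 0]).
have [Q2 hQ2] := projection_exists hip (cs (range (fun n => u (3%N, n)))).
have [Q1 hQ1] := projection_exists hip (cs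
  [set v | exists n, v = (Num.sqrt (x n))%:K *: u (1%N, n) - (Num.sqrt (1 - x n))%:K *: u (3%N, n)]).
have [hf hB] := dilation_family hu hQ1 hQ2 hQ3.
exists Q1, Q2, Q3; eexists; split; [| | |exact: hf|].
- by eexists; split; last exact: hQ1; exact: cs.
- by eexists; split; last exact: hQ2; exact: cs.
- by eexists; split; last exact: hQ3; exact: cs.
have L1 := projection_contraction hip (cs _) hQ1.
have L2 := projection_contraction hip (cs _) hQ2.
have L3 := projection_contraction hip (cs _) hQ3.
move=> p; split; last exact: hB.
do 2![apply: linear_contraction_comp => //].
by apply: linear_contraction_iter; do 2![apply: linear_contraction_comp => //].
Qed.
End Dilation.

(** * Rapidly decreasing sequences with adapted exponents *)

Section RapidSequences.
Variable R : realType.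

Lemma expr_small (c e : R) : 0 < c -> c <= 1 -> 0 < e ->
  exists n, (0 < n)%N /\ (1 - c) ^+ n <= e.
Proof.
move=> c0 c1 e0.
have : `|1 - c| < 1 by rewrite ger0_norm ?subr_ge0 // ltrBlDr ltrDl.
move=> /cvg_expr /cvgrPdist_lt /(_ e e0) [N _ /(_ N.+1 (leqnSn N))] /=.
rewrite sub0r normrN => h; exists N.+1; split => //.
exact: le_trans (ler_norm _) (ltW h).
Qed.

(** The exponent [k a] is chosen after [x a], and [x a.+1] after [k a], at most [tau a / k a]; this
    bound persists at later indices because [x] is nonincreasing. *)
Lemma rapid_sequences (tau : nat -> R) : (forall a, 0 < tau a) ->
  exists (x : nat -> R) (k : nat -> nat), forall a,
    [/\ 0 < x a <= 1, x a <= tau a, (0 < k a)%N, (1 - x a) ^+ k a <= tau a &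
        forall b, (b < a)%N -> (k b)%:R * x a <= tau b].
Proof.
move=> tau0.
have /choice[kk hkk] : forall ce : R * R, exists n,
    0 < ce.1 <= 1 -> 0 < ce.2 -> (0 < n)%N /\ (1 - ce.1) ^+ n <= ce.2.
  move=> [c e] /=; have [/andP[c0 c1]|nc] := pselect (0 < c <= 1); last by exists 0%N.
  have [e0|ne] := pselect (0 < e); last by exists 0%N.
  by have [n ?] := expr_small c0 c1 e0; exists n.
pose k_ a c := kk (c, tau a).
pose next a c := Num.min (Num.min c (tau a / (k_ a c)%:R)) (tau a.+1).
pose x := fix x a := if a is a'.+1 then next a' (x a') else Num.min 1 (tau 0%N).
have hx a : 0 < x a <= 1 /\ x a <= tau a.
  elim: a => [|a [/andP[xa0 xa1] _]].
    by rewrite /= lt_min ltr01 tau0 !ge_min !lexx orbT.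
  have [k0 _] : (0 < k_ a (x a))%N /\ (1 - x a) ^+ k_ a (x a) <= tau a.
    by apply: (hkk (x a, tau a)) => //=; rewrite xa0.
  rewrite /= /next !lt_min xa0 !tau0 divr_gt0 ?ltr0n //=.
  by rewrite !ge_min xa1 lexx /= !orbT.
have xS a b : (b <= a)%N -> x a <= x b.
  elim: a => [|a IH]; first by rewrite leqn0 => /eqP->.
  rewrite leq_eqVlt => /orP[/eqP->//|/IH h].
  by rewrite (le_trans _ h) //= /next !ge_min lexx.
exists x, (fun a => k_ a (x a)) => a.
have [xa ta] := hx a; have [k0 hk] := hkk (x a, tau a) xa (tau0 a).
split=> // b ba.
have [xb tb] := hx b; have [kb0 _] := hkk (x b, tau b) xb (tau0 b).
rewrite mulrC -ler_pdivlMr ?ltr0n //; apply: (le_trans (xS _ _ ba)).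
by rewrite /= /next !ge_min lexx orbT.
Qed.

Lemma bernoulli_sub (x : R) n : 0 <= x <= 1 -> 1 - (1 - x) ^+ n <= n%:R * x.
Proof.
move=> /andP[x0 x1]; elim: n => [|n IH]; first by rewrite expr0 subrr mul0r.
have : (1 - x) ^+ n.+1 >= (1 - x) ^+ n - x.
  rewrite exprS mulrBl mul1r lerD2l lerN2 ler_piMr //.
  by rewrite exprn_ile1 ?subr_ge0 // lerBlDr lerDl.
rewrite -natr1 mulrDl mul1r => h.
rewrite -[_ <= _]/(1 - _ <= _ + _); lra.
Qed.
End RapidSequences.

(** * Two opposite orderings of the steps *)

Section Ranks.

Definition stage n := trunc_log 2 n.

(** [3 * 2 ^ s - 1 - n] reverses time inside stage [s], whose steps run from [2 ^ s] to
    [2 ^ s.+1 - 1]. The factor 4 lifts even stages above both odd neighbours; [first_rank] keeps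
    time order and lifts the odd ones. A higher rank will mean a smaller parameter. *)
Definition last_rank n :=
  if odd (stage n) then (3 * 2 ^ stage n - 1 - n)%N
  else (4 * (3 * 2 ^ stage n - 1 - n))%N.

Definition first_rank n := if odd (stage n) then (4 * n)%N else n.

Lemma stage_bounds n : (0 < n)%N -> (2 ^ stage n <= n < 2 ^ (stage n).+1)%N.
Proof. by move=> n0; apply: trunc_log_bounds. Qed.

Lemma first_rank_ge n : (n <= first_rank n)%N.
Proof. by rewrite /first_rank; case: ifP => // _; rewrite leq_pmull. Qed.

(** Together with [first_rank_ge], turns a smallness condition on the rank into one on the step. *)
Lemma last_rank_ge n : (n <= 2 * last_rank n)%N.
Proof.
have [->//|n0] := posnP n.
have /andP[h1 h2] := stage_bounds n0; move: h2; rewrite expnS => h2.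
by rewrite /last_rank; case: ifP => _; lia.
Qed.

(* Two steps in the same or in adjacent stages are ordered oppositely by the
   two ranks. *)
Lemma rank_cases j n : (0 < j)%N -> (0 < n)%N -> j != n ->
  (stage n <= (stage j).+1)%N -> (stage j <= (stage n).+1)%N ->
  (first_rank n < first_rank j)%N \/ (last_rank n < last_rank j)%N.
Proof.
move=> j0 n0 jn.
have /andP[j1 j2] := stage_bounds j0; have /andP[n1 n2] := stage_bounds n0.
move: j1 j2 n1 n2; rewrite /first_rank /last_rank !expnS.
move: (stage j) (stage n) => s t j1 j2 n1 n2 ts st.
have : s = t \/ s = t.+1 \/ t = s.+1 by lia.
case=> [e|[e|e]]; subst => {ts st}.
- by case: ifP => _; lia.
- by move: j1 j2; rewrite /= expnS; case: (odd t) => /=; lia.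
- by move: n1 n2; rewrite /= expnS; case: (odd s) => /=; lia.
Qed.
End Ranks.

(** * Choice of the weights, factors and exponents *)

Section ParameterChoice.
Variable R : realType.

(** Cubic decay, since step [n] costs about [n * tolerance n], which must be summable. *)
Definition tolerance (n : nat) : R := (n.+1%:R ^+ 3)^-1.

Lemma tolerance_gt0 n : 0 < tolerance n.
Proof. by rewrite invr_gt0 exprn_gt0. Qed.

Lemma tolerance_mono n n' : (n <= n')%N -> tolerance n' <= tolerance n.
Proof.
move=> h; rewrite lef_pV2 ?posrE ?exprn_gt0 //.
by rewrite ler_pXn2r ?nnegrE // ler_nat ltnS.
Qed.

(* [rho] is governed by [last_rank] and [x] by [first_rank]: a step [j]
   interfering with step [n] either has a negligible weight [rho j], or has
   [x j] so small that [(1 - x j) ^+ p n] is still close to 1. *)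
Lemma parameters_exist : exists (rho x : nat -> R) (m p : nat -> nat),
  (forall n, [/\ 0 <= rho n <= 1, rho n <= tolerance n / 8, 0 <= x n <= 1,
     (0 < m n)%N /\ (0 < p n)%N & (1 - rho n) ^+ m n <= tolerance n]) /\
  (forall n, (m n)%:R * (rho n * (1 - x n) ^+ p n) <= tolerance n) /\
  (forall j n, (0 < j)%N -> (0 < n)%N -> j != n ->
     (stage n <= (stage j).+1)%N -> (stage j <= (stage n).+1)%N ->
     (m n)%:R * (rho j * (1 - (1 - x j) ^+ p n)) <= tolerance n).
Proof.
(* The 2 matches [last_rank_ge]; the 8 makes the weights [rho] small enough in total for the
   dilation. *)
have tau1_gt0 a : 0 < tolerance (2 * a) / 8 by rewrite divr_gt0 ?tolerance_gt0.
have [rho [m0 hrho]] := rapid_sequences tau1_gt0.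
pose m n := m0 (last_rank n).
(* Since [n <= first_rank n], the sum at [a = first_rank n] contains [m n]; dividing by it absorbs
   the [m n] iterations of step [n]. *)
pose tau2 a := tolerance a / (1 + \sum_(i < a.+1) m i)%:R.
have tau2_gt0 a : 0 < tau2 a by rewrite divr_gt0 ?tolerance_gt0 // ltr0n.
have [x [p0 hx]] := rapid_sequences tau2_gt0.
have m_tau2 n : (m n)%:R * tau2 (first_rank n) <= tolerance n.
  rewrite /tau2 mulrA ler_pdivrMr ?ltr0n // mulrC.
  apply: ler_pM => //; [exact/ltW/tolerance_gt0|exact/tolerance_mono/first_rank_ge|].
  rewrite ler_nat (bigD1 (inord n)) //= inordK ?ltnS ?first_rank_ge //.
  by rewrite addnCA leq_addr.
have tau1_le n : tolerance (2 * last_rank n) / 8 <= tolerance n / 8.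
  by rewrite ler_pM2r ?invr_gt0 // tolerance_mono // last_rank_ge.
have rho01 a : 0 <= rho a <= 1 by case: (hrho a) => /andP[/ltW-> ->].
have x01 a : 0 <= x a <= 1 by case: (hx a) => /andP[/ltW-> ->].
have tol8 n : tolerance n / 8 <= tolerance n.
  by rewrite ler_pdivrMr // ler_peMr ?ltW ?tolerance_gt0 // ltr1n.
have px01 a q : 0 <= (1 - x a) ^+ q <= 1.
  have /andP[xa0 xa1] := x01 a.
  by rewrite exprn_ge0 ?subr_ge0 // exprn_ile1 ?subr_ge0 // lerBlDr lerDl.
exists (rho \o last_rank), (x \o first_rank), m, (p0 \o first_rank).
split=> [n|/=]; last split=> [n|j n j0 n0 jn h1 h2].
- have [_ rt m0_gt0 re _] := hrho (last_rank n).
  have [_ _ p_gt0 _ _] := hx (first_rank n).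
  split=> //=; [exact: le_trans rt (tau1_le n)|].
  exact: le_trans re (le_trans (tau1_le n) (tol8 n)).
- have [_ _ _ xe _] := hx (first_rank n).
  apply: le_trans (m_tau2 n); rewrite ler_wpM2l // (le_trans _ xe) //.
  have /andP[r0 r1] := rho01 (last_rank n).
  by rewrite ler_piMl //; case/andP: (px01 (first_rank n) (p0 (first_rank n))).
have /andP[r0 r1] := rho01 (last_rank j).
have /andP[q0 q1] := px01 (first_rank j) (p0 (first_rank n)).
have [fl|ll] := rank_cases j0 n0 jn h1 h2.
  have [_ _ _ _ /(_ _ fl) xs] := hx (first_rank j).
  apply: le_trans (m_tau2 n); rewrite ler_wpM2l // (le_trans _ xs) //.
  apply: le_trans (bernoulli_sub _ (x01 _)).
  by rewrite ler_piMl ?subr_ge0.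
have [_ _ _ _ /(_ _ ll) rs] := hrho (last_rank j).
apply: le_trans (le_trans rs (le_trans (tau1_le n) (tol8 n))).
rewrite ler_wpM2l // ler_piMr //; lra.
Qed.
End ParameterChoice.

(** * Angles of the steps and trigonometric estimates *)

Section Trigonometry.
Variable R : realType.

Lemma sin_sqr_le (a : R) : 0 <= a -> sin a ^+ 2 <= a ^+ 2.
Proof.
rewrite le_eqVlt => /orP[/eqP<-|a0]; first by rewrite sin0.
have csin : {within `[0, a], continuous (@sin R)}.
  by apply: continuous_subspaceT => y; exact: continuous_sin.
have [xi _] := MVT a0 (fun y _ => is_derive_sin y) csin.
by rewrite sin0 !subr0 => ->; rewrite exprMn ler_piMl ?sqr_ge0.
Qed.

(** Half-angle formula: [1 - cos a] is twice the square of [sin (a / 2)]. *)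
Lemma one_sub_cos_le (a : R) : 0 <= a -> 2 * (1 - cos a) <= a ^+ 2.
Proof.
move=> a0; have a20 : 0 <= a / 2 by rewrite divr_ge0.
have := sin_sqr_le a20; have := cos2Dsin2 (a / 2).
have -> : cos a = cos (a / 2) ^+ 2 - sin (a / 2) ^+ 2.
  by rewrite {1}[a]splitr cosD !expr2.
rewrite exprMn; move: (_ / 2) => b; move: (sin b ^+ 2) (cos b ^+ 2) => S C.
lra.
Qed.

Definition increment (s : nat) : R := pi / 2 / (2 ^ s)%:R.

(** The angle reached at the end of step [n], hence [n.+1]: it goes from [increment s] at the first
    step of stage [s] to [pi / 2] at the last. *)
Definition angle (n : nat) : R :=
  (n.+1%:R / (2 ^ stage n)%:R - 1) * (pi / 2).

Lemma increment_sqr_le n : (0 < n)%N -> increment (stage n) ^+ 2 <= 16 / n%:R ^+ 2.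
Proof.
move=> n0; have /andP[n1 n2] := stage_bounds n0.
have n0' : 0 < n%:R :> R by rewrite ltr0n.
have s0 : 0 < (2 ^ stage n)%:R :> R by rewrite ltr0n expn_gt0.
have -> : 16 / n%:R ^+ 2 = (4 / n%:R) ^+ 2 :> R by field; rewrite gt_eqF.
apply: lerXn2r; rewrite ?nnegrE ?divr_ge0 ?pi_ge0 //.
rewrite /increment ler_pdivrMr // mulrAC ler_pdivlMr //.
apply: (@le_trans _ _ (2 * n%:R)).
  by rewrite ler_wpM2r // ltW // pihalf_lt2.
rewrite -!natrM ler_nat; move: n2; rewrite expnS; lia.
Qed.

Lemma angle_pred n : (2 ^ stage n < n)%N -> stage n.-1 = stage n ->
  angle n.-1 = angle n - increment (stage n).
Proof.
move=> h e; rewrite /angle /increment e.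
have -> : n.-1.+1 = n by rewrite (ltn_predK h).
rewrite -natr1; set s := (_ ^ _)%:R : R.
have s0 : s != 0 by rewrite pnatr_eq0 expn_eq0.
by field; rewrite s0.
Qed.

Lemma angle_last s : angle (2 ^ s.+1).-1 = pi / 2 /\ stage (2 ^ s.+1).-1 = s.
Proof.
have h : (0 < 2 ^ s)%N by rewrite expn_gt0.
have e : stage (2 ^ s.+1).-1 = s.
  by apply: trunc_log_eq => //; rewrite expnS; lia.
split=> //; rewrite /angle e prednK ?expn_gt0 // expnS natrM mulfK ?pnatr_eq0 ?expn_eq0 //.
lra.
Qed.

Lemma angle_first s : angle (2 ^ s) = increment s.
Proof.
rewrite /angle /increment /stage trunc_expnK // -natr1.
have s0 : (2 ^ s)%:R != 0 :> R by rewrite pnatr_eq0 expn_eq0.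
by field; rewrite s0.
Qed.
End Trigonometry.

(** * Error of one step of the walk *)

Section Walk.
Variables (R : realType) (k : scalar_kind).
Local Notation K := (scalars R k).
Local Notation "r %:K" := (of_real R k r) (at level 2, format "r %:K").
Variables (H : completeNormedModType K) (ip : {dot H for scalar_conj R k}).
Hypothesis hip : norm_from_dot ip.
Variable f : nat -> H.
Hypothesis hf : orthonormal_family ip f.

Definition plane_vec (s : nat) (a d : R) : H := a%:K *: f s + d%:K *: f s.+1.

Lemma rnorm_f s : rnorm (f s) = 1.
Proof.
apply/eqP; rewrite -(pexpr_eq1 (n := 2)) ?rnorm_ge0 //; apply/eqP.
by apply: (@of_real_inj R k); rewrite (rnorm_sqr hip) hf eqxx [RHS]rmorph1.
Qed.

Lemma rnorm_plane_vec s a d : rnorm (plane_vec s a d) <= `|a| + `|d|.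
Proof.
by apply: le_trans (ler_rnormD _ _) _; rewrite !rnormZ !rnorm_f !mulr1.
Qed.

Lemma plane_vecB s a d a' d' :
  plane_vec s a d - plane_vec s a' d' = plane_vec s (a - a') (d - d').
Proof. by rewrite /plane_vec !rmorphB !scalerBl opprD addrACA. Qed.

Lemma plane_vecZ s r a d :
  r%:K *: plane_vec s a d = plane_vec s (r * a) (r * d).
Proof. by rewrite /plane_vec scalerDr !scalerA !rmorphM. Qed.

Variables (rho x : nat -> R) (m p : nat -> nat).
Hypothesis hrho : forall n, 0 <= rho n <= 1.
Hypothesis hx : forall n, 0 <= x n <= 1.
Hypothesis hm : forall n, (0 < m n)%N.
Hypothesis hrhom : forall n, (1 - rho n) ^+ m n <= tolerance R n.
Hypothesis hself : forall n,
  (m n)%:R * (rho n * (1 - x n) ^+ p n) <= tolerance R n.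
Hypothesis hcross : forall j n, (0 < j)%N -> (0 < n)%N -> j != n ->
  (stage n <= (stage j).+1)%N -> (stage j <= (stage n).+1)%N ->
  (m n)%:R * (rho j * (1 - (1 - x j) ^+ p n)) <= tolerance R n.

(** With [right_coef], the coordinates of [sqrt (rho n)] times the unit vector orthogonal to the
    direction [angle n]. *)
Definition left_coef n := - (Num.sqrt (rho n) * sin (angle R n)).
Definition right_coef n := Num.sqrt (rho n) * cos (angle R n).
Local Notation b := left_coef.
Local Notation c := right_coef.
Local Notation beta := (incidence stage b c).

Variable B : nat -> H -> H.
Hypothesis hB : forall q, linear_contraction (B q).
Hypothesis hBf : forall q s, B q (f s) = f s -
  \sum_(n < 2 ^ s.+1) (beta n s * (1 - (1 - x n) ^+ q))%:K *:
    plane_vec (stage n) (b n) (c n).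

Lemma sin_norm_le1 (a : R) : `|sin a| <= 1.
Proof. by rewrite ler_norml sin_geN1 sin_le1. Qed.

Lemma cos_norm_le1 (a : R) : `|cos a| <= 1.
Proof. by rewrite ler_norml cos_geN1 cos_le1. Qed.

Lemma left_coef_le n : `|b n| <= Num.sqrt (rho n).
Proof.
by rewrite normrN normrM ger0_norm ?sqrtr_ge0 // ler_piMr ?sqrtr_ge0 ?sin_norm_le1.
Qed.

Lemma right_coef_le n : `|c n| <= Num.sqrt (rho n).
Proof.
by rewrite normrM ger0_norm ?sqrtr_ge0 // ler_piMr ?sqrtr_ge0 ?cos_norm_le1.
Qed.

Lemma incidence_le n s : `|beta n s| <= Num.sqrt (rho n).
Proof.
rewrite /incidence; have [e|ne] := eqVneq (stage n) s.
  by rewrite e gtn_eqF //= mul1r mul0r addr0 left_coef_le.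
rewrite mul0r add0r normrM; case: eqP => _; first by rewrite normr1 mul1r right_coef_le.
by rewrite normr0 mul0r sqrtr_ge0.
Qed.

Lemma incidence_eq0 n s : (stage n != s) -> ((stage n).+1 != s) -> beta n s = 0.
Proof. by rewrite /incidence => /negPf-> /negPf->; rewrite !mul0r addr0. Qed.

Lemma stage_gt n s : (2 ^ s.+1 <= n)%N -> (s < stage n)%N.
Proof. exact: trunc_log_max. Qed.

(** Brings the expansions for [f s] and [f s.+1] to a common range. *)
Lemma incidence_widen s q : \sum_(n < 2 ^ s.+1)
    (beta n s * (1 - (1 - x n) ^+ q))%:K *: plane_vec (stage n) (b n) (c n) =
  \sum_(n < 2 ^ s.+2)
    (beta n s * (1 - (1 - x n) ^+ q))%:K *: plane_vec (stage n) (b n) (c n).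
Proof.
have le2 : (2 ^ s.+1 <= 2 ^ s.+2)%N by rewrite leq_exp2l.
rewrite (big_ord_widen _ (fun n => (beta n s * (1 - (1 - x n) ^+ q))%:K *:
  plane_vec (stage n) (b n) (c n)) le2) big_mkcond /=.
apply: eq_bigr => n _; case: ltnP => // /stage_gt h.
rewrite incidence_eq0 ?gtn_eqF ?mul0r ?rmorph0 ?scale0r //.
exact: leqW.
Qed.

Lemma B_plane_vec q s a d : B q (plane_vec s a d) = plane_vec s a d -
  \sum_(n < 2 ^ s.+2)
    ((a * beta n s + d * beta n s.+1) * (1 - (1 - x n) ^+ q))%:K *:
      plane_vec (stage n) (b n) (c n).
Proof.
rewrite {1}/plane_vec (linear_contractionD (hB q)) !(linear_contractionZ (hB q)).
rewrite !hBf incidence_widen !scalerBr addrACA -opprD -/(plane_vec s a d).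
congr (_ - _); rewrite !scaler_sumr -big_split; apply: eq_bigr => n _ /=.
by rewrite !scalerA -scalerDl -!rmorphM -rmorphD !mulrA mulrDl.
Qed.

(** The summand is the share of step [j] in the gap between [B (p n)] and the exact rank-one
    perturbation of step [n]. The 8 is 4 from the coefficient times 2 from the vector, each with a
    factor [sqrt (rho j)]. *)
Lemma term_le j n s a d : (2 <= s)%N -> stage n = s -> `|a| <= 2 -> `|d| <= 2 ->
  (m n)%:R * rnorm ((if j == n then
      (a * beta j s + d * beta j s.+1) * (1 - x j) ^+ p n
    else - ((a * beta j s + d * beta j s.+1) * (1 - (1 - x j) ^+ p n)))%:K *:
      plane_vec (stage j) (b j) (c j)) <= 8 * tolerance R n.
Proof.
move=> s2 ns ha hd.
have r0 := sqrtr_ge0 (rho j).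
have [rho0 rho1] := andP (hrho j); have [x0 x1] := andP (hx j).
have q01 : 0 <= (1 - x j) ^+ p n <= 1.
  by rewrite exprn_ge0 ?subr_ge0 // exprn_ile1 ?subr_ge0 // lerBlDr lerDl.
have [q0 q1] := andP q01.
have coef_le : `|a * beta j s + d * beta j s.+1| <= 4 * Num.sqrt (rho j).
  apply: le_trans (ler_normD _ _) _; rewrite !normrM.
  have -> : 4 * Num.sqrt (rho j) = 2 * Num.sqrt (rho j) + 2 * Num.sqrt (rho j) by ring.
  by apply: lerD; apply: ler_pM => //; exact: incidence_le.
have vec_le : rnorm (plane_vec (stage j) (b j) (c j)) <= 2 * Num.sqrt (rho j).
  apply: le_trans (rnorm_plane_vec _ _ _) _.
  by rewrite mulr2n mulrDl mul1r lerD ?left_coef_le ?right_coef_le.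
have bound w : 0 <= w ->
    (m n)%:R * (`|a * beta j s + d * beta j s.+1| * w *
      rnorm (plane_vec (stage j) (b j) (c j))) <=
    8 * ((m n)%:R * (rho j * w)).
  move=> w0; rewrite [leRHS]mulrCA; apply: ler_wpM2l => //.
  rewrite [leLHS]mulrAC (_ : 8 * (rho j * w) = (4 * Num.sqrt (rho j)) * (2 * Num.sqrt (rho j)) * w).
    by apply: ler_wpM2r => //; apply: ler_pM => //; exact: rnorm_ge0.
  by rewrite -[in LHS](sqr_sqrtr rho0); ring.
have bound0 : 0 <= 8 * tolerance R n.
  by rewrite mulr_ge0 // ltW // tolerance_gt0.
rewrite rnormZ; have [e|jn] := eqVneq j n.
  rewrite normrM [`|_ ^+ _|]ger0_norm //; apply: le_trans (bound _ q0) _.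
  by rewrite ler_wpM2l // e hself.
rewrite normrN normrM [`|1 - _|]ger0_norm ?subr_ge0 //.
(* Steps of distant stages do not meet the plane. In the near case [2 <= s] rules out [j = 0], which
   has stage 0 by default. *)
have [/andP[sj js]|far] := boolP ((s <= (stage j).+1) && (stage j <= s.+1))%N.
  apply: (le_trans (bound _ _)); first by rewrite subr_ge0.
  rewrite ler_wpM2l // hcross ?ns //; last first.
    by case: (posnP n) => // n0; move: s2; rewrite -ns n0.
  by case: (posnP j) => // j0; move: sj; rewrite j0 /stage trunc_log0 => /(leq_trans s2).
rewrite !incidence_eq0 ?mulr0 ?addr0 ?normr0 ?mul0r ?mulr0 //;
  apply/eqP => E; case/negP: far; clear -E; lia.
Qed.

(** There are [2 ^ s.+2 <= 4 * n] terms, each at most [8 * tolerance n]. *)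
Lemma step_error n a d : (4 <= n)%N -> `|a| <= 2 -> `|d| <= 2 ->
  (m n)%:R * rnorm (B (p n) (plane_vec (stage n) a d) -
    plane_vec (stage n) (a - (a * b n + d * c n) * b n)
                        (d - (a * b n + d * c n) * c n)) <=
  32 * n%:R * tolerance R n.
Proof.
move=> n4 ha hd; set s := stage n.
have s2 : (2 <= s)%N by apply: trunc_log_max.
have n0 : (0 < n)%N by exact: leq_trans n4.
have /andP[n1 n2] := stage_bounds n0.
have nM : (n < 2 ^ s.+2)%N by apply: leq_trans n2 _; rewrite leq_exp2l.
have -> : B (p n) (plane_vec s a d) -
    plane_vec s (a - (a * b n + d * c n) * b n) (d - (a * b n + d * c n) * c n) =
  \sum_(j < 2 ^ s.+2) (if nat_of_ord j == n then
      (a * beta j s + d * beta j s.+1) * (1 - x j) ^+ p n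
    else - ((a * beta j s + d * beta j s.+1) * (1 - (1 - x j) ^+ p n)))%:K *:
      plane_vec (stage j) (b j) (c j).
  rewrite B_plane_vec addrAC plane_vecB !subKr -plane_vecZ.
  rewrite [in LHS](bigD1 (Ordinal nM)) //= [RHS](bigD1 (Ordinal nM)) //= eqxx.
  rewrite opprD addrA; congr (_ + _).
    have -> : beta n s = b n by rewrite /incidence eqxx gtn_eqF // mul1r mul0r addr0.
    have -> : beta n s.+1 = c n.
      by rewrite /incidence eqxx ltn_eqF // mul1r mul0r add0r.
    rewrite -scalerBl -rmorphB; congr (_%:K *: _).
    by rewrite -[X in X - _]mulr1 -mulrBr subKr.
  rewrite -sumrN; apply: eq_bigr => j jn.
  rewrite -[n]/(nat_of_ord (Ordinal nM)) (inj_eq val_inj) (negPf jn).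
  by rewrite rmorphN scaleNr.
apply: (le_trans (ler_wpM2l (ler0n _ _) (ler_rnorm_sum _ _ _))).
rewrite mulr_sumr.
apply: (@le_trans _ _ (\sum_(j < 2 ^ s.+2) (8 * tolerance R n))).
  by apply: ler_sum => j _; apply: term_le.
rewrite sumr_const card_ord -[leLHS]mulr_natl mulrA.
apply: ler_wpM2r; first by rewrite ltW // tolerance_gt0.
rewrite -!natrM ler_nat !expnS; clear -n1; rewrite -/s in n1; lia.
Qed.

Section Step.
Variable n : nat.
Hypothesis n4 : (4 <= n)%N.
Let s := stage n.
Let phi := angle R n.
Let theta := increment R s.

(** The exact orbit from angle [phi - theta]: the component [cos theta] along the new direction is
    kept, and the orthogonal one is multiplied by [1 - rho n] each time. *)
Let path l := plane_vec s
  (cos theta * cos phi + (1 - rho n) ^+ l * (sin theta * sin phi))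
  (cos theta * sin phi - (1 - rho n) ^+ l * (sin theta * cos phi)).

Let pow01 l : 0 <= (1 - rho n) ^+ l <= 1.
Proof.
have [r0 r1] := andP (hrho n).
by rewrite exprn_ge0 ?subr_ge0 // exprn_ile1 ?subr_ge0 // lerBlDr lerDl.
Qed.

Let prod_le1 (u v : R) : `|u| <= 1 -> `|v| <= 1 -> `|u * v| <= 1.
Proof. by move=> hu hv; rewrite normrM mulr_ile1. Qed.

Let path_error l : (m n)%:R * rnorm (B (p n) (path l) - path l.+1) <=
  32 * n%:R * tolerance R n.
Proof.
have pow_le : `|(1 - rho n) ^+ l| <= 1.
  by have [q0 q1] := andP (pow01 l); rewrite ger0_norm.
have hA : `|cos theta * cos phi + (1 - rho n) ^+ l * (sin theta * sin phi)| <= 2.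
  apply: le_trans (ler_normD _ _) _.
  by apply: lerD; do ?apply: prod_le1; rewrite ?sin_norm_le1 ?cos_norm_le1.
have hD : `|cos theta * sin phi - (1 - rho n) ^+ l * (sin theta * cos phi)| <= 2.
  apply: le_trans (ler_normB _ _) _.
  by apply: lerD; do ?apply: prod_le1; rewrite ?sin_norm_le1 ?cos_norm_le1.
have := step_error n4 hA hD.
have [r0 r1] := andP (hrho n).
have sq := sqr_sqrtr r0.
have cs := cos2Dsin2 phi.
rewrite -/s /left_coef /right_coef -/phi /path.
set q := (1 - rho n) ^+ l; rewrite exprS -/q.
set r := Num.sqrt (rho n); move: sq; rewrite -/r => sq.
(* The real dot product of the coordinates of [path l] with [left_coef n] and [right_coef n]. *)
set kappa := (_ * - (r * sin phi) + _).
have -> : kappa = - (r * q * sin theta).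
  transitivity (- (r * q * sin theta) * (cos phi ^+ 2 + sin phi ^+ 2)).
    by rewrite /kappa; ring.
  by rewrite cs mulr1.
congr (_ * rnorm (_ - plane_vec _ _ _) <= _); rewrite -sq; ring.
Qed.

(** A contraction does not amplify earlier errors, so they only add up. *)
Let iter_error l : (m n)%:R * rnorm (iter l (B (p n)) (path 0) - path l) <=
  l%:R * (32 * n%:R * tolerance R n).
Proof.
elim: l => [|l IH]; first by rewrite subrr rnorm0 mulr0 mul0r.
rewrite iterS -natr1 mulrDl mul1r.
have := path_error l.
have : rnorm (B (p n) (iter l (B (p n)) (path 0)) - path l.+1) <=
  rnorm (iter l (B (p n)) (path 0) - path l) + rnorm (B (p n) (path l) - path l.+1).
  have := ler_rnormD (B (p n) (iter l (B (p n)) (path 0)) - B (p n) (path l))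
    (B (p n) (path l) - path l.+1).
  rewrite addrA subrK => /le_trans; apply; rewrite lerD2r.
  exact: linear_contraction_dist.
move=> /(ler_wpM2l (ler0n R (m n))); rewrite mulrDr => h1 h2.
by apply: le_trans h1 _; apply: lerD.
Qed.

Lemma walk_step :
  rnorm (iter (m n) (B (p n)) (plane_vec s (cos (phi - theta)) (sin (phi - theta))) -
    plane_vec s (cos phi) (sin phi)) <=
  32 * n%:R * tolerance R n + 2 * tolerance R n + 2 * (1 - cos theta).
Proof.
have -> : plane_vec s (cos (phi - theta)) (sin (phi - theta)) = path 0.
  rewrite /path cosB sinB expr0 !mul1r.
  by congr (plane_vec _ _ _); ring.
have := ler_rnormD (iter (m n) (B (p n)) (path 0) - path (m n))
  (path (m n) - plane_vec s (cos phi) (sin phi)).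
rewrite addrA subrK => /le_trans; apply; rewrite -[leRHS]addrA; apply: lerD.
  (* At [l = m n] the number of iterations cancels the factor [m n] carried so far. *)
  by have := iter_error (m n); rewrite ler_pM2l ?ltr0n // hm.
rewrite /path plane_vecB; apply: le_trans (rnorm_plane_vec _ _ _) _.
have [q0 _] := andP (pow01 (m n)).
have qt := hrhom n.
have piece (u v w : R) : `|u| <= 1 -> `|v| <= 1 -> `|w| <= 1 ->
  `|(cos theta - 1) * u + (1 - rho n) ^+ m n * (v * w)| <=
    (1 - cos theta) + tolerance R n.
  move=> hu hv hw; apply: le_trans (ler_normD _ _) _; apply: lerD.
    rewrite normrM [`|cos theta - 1|]distrC [`|1 - _|]ger0_norm ?subr_ge0 ?cos_le1 //.
    by rewrite ler_piMr ?subr_ge0 ?cos_le1.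
  rewrite normrM [`|_ ^+ _|]ger0_norm //; apply: le_trans qt.
  by rewrite ler_piMr // prod_le1.
have h1 := piece (cos phi) (sin theta) (sin phi) (cos_norm_le1 _) (sin_norm_le1 _) (sin_norm_le1 _).
have h2 := piece (sin phi) (- sin theta) (cos phi) (sin_norm_le1 _).
rewrite normrN in h2; have {}h2 := h2 (sin_norm_le1 _) (cos_norm_le1 _).
have -> : cos theta * cos phi + (1 - rho n) ^+ m n * (sin theta * sin phi) - cos phi =
  (cos theta - 1) * cos phi + (1 - rho n) ^+ m n * (sin theta * sin phi) by ring.
have -> : cos theta * sin phi - (1 - rho n) ^+ m n * (sin theta * cos phi) - sin phi =
  (cos theta - 1) * sin phi + (1 - rho n) ^+ m n * (- sin theta * cos phi) by ring.
apply: le_trans (lerD h1 h2) _; rewrite le_eqVlt; apply/orP; left; apply/eqP; ring.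
Qed.
End Step.
End Walk.

(** * Summation of the errors and divergence *)

Section Divergence.
Variables (R : realType) (k : scalar_kind).
Local Notation K := (scalars R k).
Local Notation "r %:K" := (of_real R k r) (at level 2, format "r %:K").
Variables (H : completeNormedModType K) (ip : {dot H for scalar_conj R k}).
Hypothesis hip : norm_from_dot ip.

Lemma sum_tolerance n : \sum_(i < n) tolerance R i <= 2.
Proof.
(* A sharper bound that passes through the induction. *)
suff : \sum_(i < n) tolerance R i <= 2 - 2 / n.+1%:R.
  by move=> /le_trans; apply; rewrite lerBlDr lerDl divr_ge0.
elim: n => [|n IH]; first by rewrite big_ord0 divr1 subrr.
rewrite big_ord_recr /=; apply: le_trans (lerD IH (lexx _)) _.
rewrite /tolerance -[n.+2%:R]natr1; have : 1 <= n.+1%:R :> R by rewrite ler1n.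
move: (n.+1%:R) => y y1; rewrite -subr_ge0.
have y0 : y != 0 by rewrite gt_eqF // (lt_le_trans ltr01).
have y10 : y + 1 != 0 by rewrite gt_eqF // ltr_wpDl // (le_trans ler01).
have -> : 2 - 2 / (y + 1) - (2 - 2 / y + (y ^+ 3)^-1) =
    (2 * y ^+ 2 - y - 1) / (y ^+ 3 * (y + 1)) :> R.
  by field; rewrite y0 y10.
apply: divr_ge0; last by rewrite mulr_ge0 ?exprn_ge0 ?addr_ge0 // (le_trans ler01).
nra.
Qed.

Definition target (f : nat -> H) (n : nat) : H :=
  plane_vec f (stage n) (cos (angle R n)) (sin (angle R n)).

Lemma target_last f s : target f (2 ^ s.+1).-1 = f s.+1.
Proof.
have [a st] := angle_last R s.
by rewrite /target a st cos_pihalf sin_pihalf /plane_vec rmorph0 scale0r add0r rmorph1 scale1r.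
Qed.

(** At a change of stage, angle [pi / 2] in the old plane and angle 0 in the new one are the same
    basis vector. *)
Lemma target_pred f n : (2 <= n)%N ->
  target f n.-1 = plane_vec f (stage n)
    (cos (angle R n - increment R (stage n))) (sin (angle R n - increment R (stage n))).
Proof.
move=> n2; have n0 : (0 < n)%N by exact: leq_trans n2.
have /andP[h1 h2] := stage_bounds n0.
move: h1; rewrite leq_eqVlt => /orP[/eqP e|lt].
  have s0 : (0 < stage n)%N by apply: trunc_log_max.
  move: s0 e; case: (stage n) => // s _ <-.
  rewrite angle_first subrr target_last cos0 sin0.
  by rewrite /plane_vec rmorph0 scale0r addr0 rmorph1 scale1r.
have st : stage n.-1 = stage n by apply: trunc_log_eq => //; lia.
by rewrite /target st angle_pred.
Qed.

(** All terms on the left are of order [1 / n^2]; the right side is chosen to telescope along the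
    walk. *)
Lemma step_total n : (4 <= n)%N ->
  32 * n%:R * tolerance R n + 2 * tolerance R n +
    2 * (1 - cos (increment R (stage n))) <=
  64 / n.-1%:R - 64 / n%:R.
Proof.
move=> n4; have n0 : (0 < n)%N by exact: leq_trans n4.
have i0 : 0 <= increment R (stage n) by rewrite !divr_ge0 // pi_ge0.
apply: le_trans (lerD (lexx _) (le_trans (one_sub_cos_le i0) (increment_sqr_le R n0))) _.
rewrite /tolerance -[n.+1%:R]natr1; have : 4 <= n%:R :> R by rewrite ler_nat.
have -> : n.-1%:R = n%:R - 1 :> R by rewrite -subn1 natrB.
move: (n%:R) => y y4; rewrite -subr_ge0.
have y0 : 0 < y by lra.
have y1 : 0 < y + 1 by lra.
have y2 : 0 < y - 1 by lra.
have -> : 64 / (y - 1) - 64 / y - (32 * y / (y + 1) ^+ 3 + 2 / (y + 1) ^+ 3 + 16 / y ^+ 2) =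
  (64 * y * (y + 1) ^+ 3 - (32 * y + 2) * y ^+ 2 * (y - 1) - 16 * (y - 1) * (y + 1) ^+ 3) /
  (y ^+ 2 * (y - 1) * (y + 1) ^+ 3).
  by field; rewrite !gt_eqF.
apply: divr_ge0; last by rewrite !mulr_ge0 ?exprn_ge0 // ltW.
have -> : 64 * y * (y + 1) ^+ 3 - (32 * y + 2) * y ^+ 2 * (y - 1) - 16 * (y - 1) * (y + 1) ^+ 3 =
  16 * y ^+ 4 + 190 * y ^+ 3 + 194 * y ^+ 2 + 96 * y + 16 by ring.
by rewrite !addr_ge0 ?mulr_ge0 ?exprn_ge0 // ltW.
Qed.

Lemma orthonormal_dist (f : nat -> H) i j : orthonormal_family ip f -> i != j ->
  1 <= rnorm (f i - f j).
Proof.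
move=> hf ij; rewrite -(ler_pXn2r (n := 2)) ?nnegrE ?rnorm_ge0 // expr1n.
rewrite (pythagoras hip) ?rnormN; last first.
  have -> : ip (f i) (- f j) = - ip (f i) (f j) by exact: linearNr.
  by rewrite hf (negPf ij) oppr0.
by rewrite (rnorm_f hip hf) (rnorm_f hip hf) expr1n lerDl.
Qed.

(** The norm condition of [dilation]: each square is at most [rho n], so their sum is at most
    [2 / 8]. *)
Lemma incidence_sum_le (rho : nat -> R) s :
  (forall n, 0 <= rho n <= 1) -> (forall n, rho n <= tolerance R n / 8) ->
  2 * \sum_(n < 2 ^ s.+1)
    incidence stage (left_coef rho) (right_coef rho) n s ^+ 2 <= 1.
Proof.
move=> rho01 rhot.
have h : \sum_(n < 2 ^ s.+1)
    incidence stage (left_coef rho) (right_coef rho) n s ^+ 2 <=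
    \sum_(n < 2 ^ s.+1) tolerance R n / 8.
  apply: ler_sum => n _; apply: le_trans (rhot n).
  have [r0 _] := andP (rho01 n).
  rewrite -[leRHS](sqr_sqrtr r0) -[leLHS]real_normK ?num_real //.
  apply: lerXn2r; rewrite ?nnegrE ?sqrtr_ge0 //.
  exact: incidence_le.
move: h; rewrite -mulr_suml; have := sum_tolerance (2 ^ s.+1).
move: (\sum_(n < _) tolerance R n) => S hS hI; lra.
Qed.

Section Sequence.
Variables (f : nat -> H) (A : nat -> H -> H) (n0 : nat).
Hypothesis n0_gt : (4 <= n0)%N.
Hypothesis hA : forall n, linear_contraction (A n).
Hypothesis hstep : forall n, (4 <= n)%N ->
  rnorm (A n (target f n.-1) - target f n) <= 64 / n.-1%:R - 64 / n%:R.

Lemma ordered_prod_near j :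
  rnorm (ordered_prod (fun i => A (i + n0)%N) j (target f n0) - target f (j + n0)) <=
  64 / n0%:R - 64 / (j + n0)%:R.
Proof.
elim: j => [|j IH]; first by rewrite !subrr rnorm0.
have := hstep (leq_trans n0_gt (leq_addl j.+1 n0)).
rewrite addSn /= -/ordered_prod => h.
set X := ordered_prod _ j _ in IH *; set N := (j + n0)%N in IH h *.
have := ler_rnormD (A N.+1 X - A N.+1 (target f N)) (A N.+1 (target f N) - target f N.+1).
rewrite addrA subrK => /le_trans; apply.
have -> : 64 / n0%:R - 64 / N.+1%:R =
    (64 / n0%:R - 64 / N%:R) + (64 / N%:R - 64 / N.+1%:R) :> R by rewrite addrA subrK.
by apply: lerD => //; apply: le_trans IH; exact: linear_contraction_dist.
Qed.

Hypothesis hf : orthonormal_family ip f.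
Hypothesis n0_big : (255 <= n0)%N.

(** A limit would be within [1 / 8 + 64 / 255] of every late [f s]. Twice this is less than 1, while
    distinct [f s] are at distance at least 1. *)
Lemma ordered_prod_diverges :
  ~ cvgn (fun j => ordered_prod (fun i => A (i + n0)%N) j.+1 (target f n0)).
Proof.
set X := fun j => _; move=> cX.
have e0 : 0 < (8^-1 : R)%:K by rewrite -(rmorph0 (of_real R k)) ltr_of_real.
have /cvgrPdist_lt/(_ _ e0) [N _ hN] := cX.
have near_f s : (N + n0 < s)%N -> rnorm (lim (X @ \oo) - f s.+1) <= 8^-1 + 64 / 255.
  move=> hs; have s2 : (s < 2 ^ s.+1)%N.
    by apply: leq_trans (ltn_expl s (ltnSn 1)) _; rewrite leq_exp2l.
  (* Chosen so that the [j.+1]-st factor is the last step of stage [s], where the target is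
     [f s.+1]. *)
  pose j := ((2 ^ s.+1).-1 - n0.+1)%N.
  have jE : (j.+1 + n0 = (2 ^ s.+1).-1)%N by rewrite /j; clear -hs s2; lia.
  have /hN /= : (N <= j)%N by rewrite /j; clear -hs s2; lia.
  rewrite -rnormE ltr_of_real => h1.
  have := ordered_prod_near j.+1; rewrite jE target_last => h2.
  have -> : lim (X @ \oo) - f s.+1 = (lim (X @ \oo) - X j) + (X j - f s.+1).
    by rewrite addrA subrK.
  apply: le_trans (ler_rnormD _ _) _; apply: lerD; first exact: ltW.
  apply: le_trans h2 _; apply: (@le_trans _ _ (64 / n0%:R)).
    by rewrite lerBlDr lerDl divr_ge0.
  by rewrite ler_pM2l // lef_pV2 ?posrE ?ltr0n ?ler_nat // (leq_trans _ n0_gt).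
have h1 := near_f (N + n0).+1 (ltnSn _).
have h2 := near_f (N + n0).+2 (leqW (ltnSn _)).
have := @orthonormal_dist f (N + n0).+2 (N + n0).+3 hf.
rewrite ltn_eqF // => /(_ isT).
have := ler_rnormB (lim (X @ \oo) - f (N + n0).+3) (lim (X @ \oo) - f (N + n0).+2).
rewrite opprB [_ + (f _ - _)]addrC addrA subrK.
lra.
Qed.
End Sequence.
End Divergence.

(** * Assembly of the dilation and the walk *)

Unset Implicit Arguments.

Theorem mainTheorem2 (R : realType) (k : scalar_kind)
    (H : completeNormedModType (scalars R k))
    (ip : {dot H for scalar_conj R k})
    (hip : norm_from_dot ip)
    (hdim : ~ finite_dimensional H) :
  exists (Q1 Q2 Q3 : H -> H) (x : H) (m p : nat -> nat),
    [/\ orthogonal_projection ip Q1,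
        orthogonal_projection ip Q2,
        orthogonal_projection ip Q3,
        (forall i : nat, (1 <= i)%N -> (1 <= m i)%N /\ (1 <= p i)%N)
      & ~ cvgn (fun j : nat =>
            ordered_prod
              (fun i => iter (m i)
                 (Q3 \o iter (p i) (Q2 \o Q1 \o Q2) \o Q3))
              j.+1 x)].
Proof.
have [rho [x [m [p [hpar [hself hcross]]]]]] := parameters_exist R.
have rho01 n : 0 <= rho n <= 1 by case: (hpar n).
have x01 n : 0 <= x n <= 1 by case: (hpar n).
have m_gt0 n : (0 < m n)%N by case: (hpar n) => _ _ _ [].
have p_gt0 n : (0 < p n)%N by case: (hpar n) => _ _ _ [].
have [Q1 [Q2 [Q3 [f [oQ1 oQ2 oQ3 hf hB]]]]] :=
  @dilation R k H ip hip hdim stage (fun s => 2 ^ s.+1)%N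
    (left_coef rho) (right_coef rho) x (fun n s => @stage_gt n s) x01
    (fun s => incidence_sum_le s rho01 (fun n => let: And5 _ h _ _ _ := hpar n in h)).
pose A n := iter (m n) (Q3 \o iter (p n) (Q2 \o Q1 \o Q2) \o Q3).
have hA n : linear_contraction (A n).
  by apply: linear_contraction_iter; case: (hB (p n)).
have hstep n : (4 <= n)%N ->
    rnorm (A n (target f n.-1) - target f n) <= 64 / n.-1%:R - 64 / n%:R.
  move=> n4; rewrite target_pred; last exact: leq_trans n4.
  apply: le_trans (step_total R n4).
  apply: (walk_step hip hf rho01 x01 m_gt0 _ hself hcross
    (B := fun q => Q3 \o iter q (Q2 \o Q1 \o Q2) \o Q3)) => //.
  - by move=> i; case: (hpar i).
  - by move=> q; case: (hB q).
  - by move=> q s; case: (hB q).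
(* As [255 = 2 ^ 8 - 1] ends stage 7, the starting vector is [f 8], and the first factor, at
   [i = 1], is step 256. *)
exists Q1, Q2, Q3, (target f 255), (fun i => m (i + 255)%N), (fun i => p (i + 255)%N).
split=> // cv.
exact: (@ordered_prod_diverges R k H ip hip f A 255 isT hA hstep hf isT cv).
Qed.
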